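(* Let $G_1,G_2$ be strongly regular graphs with parameters $(n_1,k_1,a_1,c_1)$ and $(n_2,k_2,a_2,c_2)$ and vertex sets $V_1,V_2$, respectively. Define $$(d_{G_1},d_{G_2}):(V_1\times V_2)\times(V_1\times V_2)\to\{0,1,2\}\times\{0,1,2\},\qquad ((u_1,u_2),(v_1,v_2))\mapsto(d_{G_1}(u_1,v_1),d_{G_2}(u_2,v_2)).$$ Then the Cartesian product $G_1\times G_2$ is $(d_{G_1},d_{G_2})$-equitable with quotient matrix (rows and columns indexed in the order $(0,0),(0,1),(0,2),(1,0),(1,1),(1,2),(2,0),(2,1),(2,2)$) $$Q=\left(\begin{array}{ccccccccc} 0&1&0&1&0&0&0&0&0\\ k_2&a_2&c_2&0&1&0&0&0&0\\ 0&-a_2+k_2-1&k_2-c_2&0&0&1&0&0&0\\ k_1&0&0&a_1&1&0&c_1&0&0\\ 0&k_1&0&k_2&a_1+a_2&c_2&0&c_1&0\\ 0&0&k_1&0&-a_2+k_2-1&a_1-c_2+k_2&0&0&c_1\\ 0&0&0&-a_1+k_1-1&0&0&k_1-c_1&1&0\\ 0&0&0&0&-a_1+k_1-1&0&k_2&a_2-c_1+k_1&c_2\\ 0&0&0&0&0&-a_1+k_1-1&0&-a_2+k_2-1&-c_1-c_2+k_1+k_2 \end{array}\right).$$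
   Context: Graphs are finite, simple and undirected; $N(v)$ is the neighbour set of $v$, and $d_G$ is the graph distance. A $k$-regular connected graph $G$ of diameter $\Delta$ is distance-regular with intersection array $\{b_0=k,b_1,\ldots,b_{\Delta-1};c_1=1,\ldots,c_{\Delta}\}$ if for any vertices $u,v$ at distance $i$ there are exactly $c_i$ neighbours of $u$ at distance $i-1$ from $v$ and exactly $b_i$ neighbours of $u$ at distance $i+1$ from $v$. A strongly regular graph is a distance-regular graph of diameter $2$; its parameters are $(n,k,a,c)$, where $n$ is the number of vertices, $k=b_0$ is the valency, $a=k-b_1-1$ and $c=c_2$ (i.e. adjacent vertices have $a$ common neighbours, vertices at distance 2 have $c$ common neighbours). Cartesian product $G\times G'$: vertex set $V\times V'$, with $(u,u')$ adjacent to $(v,v')$ iff ($u=v$ and $u'\sim v'$) or ($u\sim v$ and $u'=v'$). Equitable partition: a partition $\{V_0,\ldots,V_r\}$ of the vertex set into nonempty sets is equitable if for all $i,j$ and all $u,v\in V_j$, $|N(u)\cap V_i|=|N(v)\cap V_i|$. Its quotient matrix is $(q_{ij})$ with $q_{ij}=|N(v)\cap V_i|$ for any $v\in V_j$. $f$-equitable graph: for a graph with vertex set $V$ and $f:V\times V\to\{x_0,\ldots,x_r\}$, let $F_{x_i}(o)=\{v\in V: f(o,v)=x_i\}$ and $P_o=\{F_{x_0}(o),\ldots,F_{x_r}(o)\}$. The graph is $f$-equitable if for every $o\in V$: (1) $F_{x_0}(o)=\{o\}$; (2) $P_o$ is an equitable partition; (3) the quotient matrix of $P_o$, indexed by $x_0,\ldots,x_r$,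 does not depend on $o$. This common matrix is the quotient matrix of the $f$-equitable graph. Here the distinguished value $x_0$ is $(0,0)$. *)

(* Defs.v *)
From mathcomp Require Import all_boot all_order all_algebra.

Set Implicit Arguments.
Unset Strict Implicit.
Unset Printing Implicit Defensive.

Record sgraph := SGraph {
  vert :> finType;
  adj : rel vert;
  adj_sym : symmetric adj;
  adj_irr : irreflexive adj }.

Section Graph.
Variable G : sgraph.
Implicit Types u v w o : G.

Definition nbr v : {set G} := [set w | adj v w].

Definition walk u v (n : nat) : bool :=
  [exists p : n.-tuple G, path (@adj G) u p && (last u p == v)].

(* Length of a shortest walk; a shortest walk has fewer than #|G| edges, so
   the search range is large enough.  Junk value #|G| when u and v lie in
   different components. *)
Definition gdist u v : nat := find (walk u v) (iota 0 #|G|).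

Definition connected : Prop := forall u v, connect (@adj G) u v.

Definition regular (k : nat) : Prop := forall v, #|nbr v| = k.

Definition diameter : nat := \max_(u : G) \max_(v : G) gdist u v.

(* Only the values b 0, ..., b (D - 1) and c 1, ..., c D are constrained. *)
Definition distance_regular (k D : nat) (b c : nat -> nat) : Prop :=
  [/\ regular k, connected, diameter = D, b 0 = k /\ c 1 = 1 &
   forall u v,
     (0 < gdist u v ->
        #|[set w in nbr u | (gdist w v).+1 == gdist u v]| = c (gdist u v)) /\
     (gdist u v < D ->
        #|[set w in nbr u | gdist w v == (gdist u v).+1]| = b (gdist u v))].

Definition strongly_regular (n k a c : nat) : Prop :=
  exists b' c' : nat -> nat,
    [/\ distance_regular k 2 b' c', #|G| = n,
        (Posz a = Posz k - Posz (b' 1%N) - 1)%R & c = c' 2].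

Definition equitable (P : {set {set G}}) : Prop :=
  partition P [set: G] /\
  forall A B, A \in P -> B \in P ->
    {in B &, forall u v, #|nbr u :&: A| = #|nbr v :&: A|}.

(* Column j lists the numbers of neighbours of a vertex of the j-th cell. *)
Definition is_quotient_matrix (m : nat) (C : 'I_m -> {set G})
    (Q : 'M[int]_m) : Prop :=
  forall i j v, v \in C j -> Q i j = Posz #|nbr v :&: C i|.

Definition level (X : eqType) (f : G * G -> X) o (x : X) : {set G} :=
  [set v | f (o, v) == x].

(* The values x_0, ..., x_r of f are listed by the tuple x.  The cells being
   nonempty and covering G, Q is unique as soon as G is nonempty. *)
Definition f_equitable (X : eqType) (r : nat) (f : G * G -> X)
    (x : r.+1.-tuple X) (Q : 'M[int]_r.+1) : Prop :=
  [/\ uniq x, forall u v, f (u, v) \in x &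
   forall o,
     [/\ level f o (tnth x ord0) = [set o],
         equitable [set level f o (tnth x i) | i : 'I_r.+1] &
         is_quotient_matrix (fun i => level f o (tnth x i)) Q]].

End Graph.

Section CartesianProduct.
Variables G1 G2 : sgraph.

Definition cart_adj : rel (G1 * G2) := fun u v =>
  (u.1 == v.1) && adj u.2 v.2 || adj u.1 v.1 && (u.2 == v.2).

Lemma cart_adj_sym : symmetric cart_adj.
Proof.
move=> u v; rewrite /cart_adj [u.1 == _]eq_sym [u.2 == _]eq_sym.
by rewrite [adj u.1 _]adj_sym [adj u.2 _]adj_sym.
Qed.

Lemma cart_adj_irr : irreflexive cart_adj.
Proof. by move=> u; rewrite /cart_adj !adj_irr andbF. Qed.

Definition cart : sgraph := SGraph cart_adj_sym cart_adj_irr.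

Definition dist_pair (p : (G1 * G2) * (G1 * G2)) : nat * nat :=
  (gdist p.1.1 p.2.1, gdist p.1.2 p.2.2).

End CartesianProduct.

Definition dist_values : 9.-tuple (nat * nat) :=
  [tuple (0, 0); (0, 1); (0, 2);
         (1, 0); (1, 1); (1, 2);
         (2, 0); (2, 1); (2, 2)].

Definition mx_of_rows (m : nat) (s : seq (seq int)) : 'M[int]_m :=
  (\matrix_(i < m, j < m) nth 0 (nth [::] s i) j)%R.

Definition srg_cart_matrix (k1 a1 c1 k2 a2 c2 : int) : 'M[int]_9 :=
  mx_of_rows 9 (
  [:: [:: 0;  1;            0;       1;            0;            0;            0;       0;            0];
      [:: k2; a2;           c2;      0;            1;            0;            0;       0;            0];
      [:: 0;  - a2 + k2 - 1; k2 - c2; 0;            0;            1;            0;       0;            0];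
      [:: k1; 0;            0;       a1;           1;            0;            c1;      0;            0];
      [:: 0;  k1;           0;       k2;           a1 + a2;      c2;           0;       c1;           0];
      [:: 0;  0;            k1;      0;            - a2 + k2 - 1; a1 - c2 + k2; 0;       0;            c1];
      [:: 0;  0;            0;       - a1 + k1 - 1; 0;            0;            k1 - c1; 1;            0];
      [:: 0;  0;            0;       0;            - a1 + k1 - 1; 0;            k2;      a2 - c1 + k1; c2];
      [:: 0;  0;            0;       0;            0;            - a1 + k1 - 1; 0;       - a2 + k2 - 1; - c1 - c2 + k1 + k2]
  ])%R.

(* Main.v *)
(** In a strongly regular graph a vertex [v] at distance [s] from [o] has a
    number [q t s] of neighbours at distance [t] from [o] that depends only on
    [s] and [t].  A neighbour of [v] in the product changes exactly one
    coordinate, so a vertex of cell [(s1, s2)] has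
    [[s1 = t1] q2 t2 s2 + [s2 = t2] q1 t1 s1] neighbours in cell [(t1, t2)]. *)
Require Import Defs.
From mathcomp Require Import all_boot all_order all_algebra.
From mathcomp Require Import zify.

Set Implicit Arguments.
Unset Strict Implicit.
Unset Printing Implicit Defensive.

Section GraphDistance.
Variable G : sgraph.
Implicit Types u v w o : G.

Lemma walk0 u v : walk u v 0 = (u == v).
Proof.
apply/existsP/eqP => [[p /andP[_ /eqP]]|->]; first by rewrite tuple0.
by exists [tuple] => /=.
Qed.

Lemma walk1 u v : walk u v 1 = adj u v.
Proof.
apply/existsP/idP => [[p]|uv]; last by exists [tuple v]; rewrite /= uv eqxx.
by case/tupleP: p => x p; rewrite tuple0 /= andbT => /andP[ux /eqP<-].
Qed.

Lemma walk2P u v : reflect (exists2 w, adj u w & adj w v) (walk u v 2).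
Proof.
apply: (iffP existsP) => [[p]|[w uw wv]]; last first.
  by exists [tuple w; v]; rewrite /= uw wv eqxx.
case/tupleP: p => x p; case/tupleP: p => y p; rewrite tuple0 /= andbT.
by case/andP=> /andP[ux xy] /eqP<-; exists x.
Qed.

Lemma gdist_eq0 u v : (gdist u v == 0) = (u == v).
Proof.
have: 0 < #|G| by apply/card_gt0P; exists u.
by rewrite /gdist -walk0; case: #|G| => //= n _; case: ifP.
Qed.

Lemma gdist_eq1 u v : (gdist u v == 1) = adj u v.
Proof.
case: (eqVneq u v) => [->|uv].
  by rewrite adj_irr (eqP (_ : gdist v v == 0)) // gdist_eq0.
(* With two distinct vertices the search range contains [1], and the junk value [#|G|] cannot be
   mistaken for distance 1. *)
have: 1 < #|G| by apply/card_gt1P; exists u, v.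
rewrite /gdist; case: #|G| => [|[|n]] //= _.
by rewrite walk0 (negPf uv) walk1; case: ifP.
Qed.

(** A connecting path can be shortened to one without repeated vertices; its length is then below
    [#|G|], so the search defining [gdist] succeeds within its range. *)
Lemma walk_gdist u v : connect (@adj G) u v -> walk u v (gdist u v).
Proof.
case/connectP=> p0 /shortenP[p pth unq _] ->; set x := last u p.
have lt_p: size p < #|G|.
  by rewrite -ltnS -/(size (u :: p)) -(card_uniqP unq) ltnS max_card.
have hw: has (walk u x) (iota 0 #|G|).
  apply/hasP; exists (size p); first by rewrite mem_iota.
  by apply/existsP; exists (in_tuple p); rewrite /= pth eqxx.
have := nth_find 0 hw; rewrite nth_iota //.
by move: hw; rewrite has_find size_iota.
Qed.

End GraphDistance.

(** Quotient matrix of the distance partition of one factor, with row [t] and column [s]; the entry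
    [- a + k - 1] is the intersection number $b_1$. *)
Definition srg_intersection (k a c : int) (t s : nat) : int :=
  (nth 0 (nth [::] [:: [:: 0; 1; 0];
                       [:: k; a; c];
                       [:: 0; - a + k - 1; k - c]] t) s)%R.

Section StronglyRegular.
Variables (G : sgraph) (n k a c : nat).
Hypothesis srgG : strongly_regular G n k a c.
Implicit Types u v w o : G.

Lemma srg_gdist_le2 u v : gdist u v <= 2.
Proof.
have [b' [c' [[_ _ <- _ _] _ _ _]]] := srgG.
by apply: (bigmax_sup u) => //; apply: (bigmax_sup v).
Qed.

(** Distances 0 and 1 mean equality and adjacency, both symmetric relations; the bound 2 leaves a
    single further value. *)
Lemma srg_gdistC u v : gdist u v = gdist v u.
Proof.
have := srg_gdist_le2 u v; have := srg_gdist_le2 v u.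
have := gdist_eq0 v u; have := gdist_eq1 v u.
rewrite adj_sym -gdist_eq1 [v == u]eq_sym -gdist_eq0.
by case: (gdist u v) (gdist v u) => [|[|[|?]]] [|[|[|?]]].
Qed.

Lemma srg_card_nbr v : #|nbr v| = k.
Proof. by have [b' [c' [[]]]] := srgG. Qed.

Lemma srg_card_nbr_split o v :
  #|[set w in nbr v | gdist o w == 0]| + #|[set w in nbr v | gdist o w == 1]|
    + #|[set w in nbr v | gdist o w == 2]| = k.
Proof.
rewrite -(srg_card_nbr v) -!sum1_card.
rewrite !(big_mkcond (fun w => w \in _)) -!big_split /=.
apply: eq_bigr => w _; rewrite !inE; have := srg_gdist_le2 o w.
by case: (adj v w) (gdist o w) => [] [|[|[|?]]].
Qed.

(** In each column, [card0] gives the entry for [t = 0], distance-regularity gives a second one, and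
    the third follows because the column sums to [k]. *)
Lemma srg_card_nbr_level o v t : t <= 2 ->
  Posz #|[set w in nbr v | gdist o w == t]|
    = srg_intersection (Posz k) (Posz a) (Posz c) t (gdist o v).
Proof.
move=> t2; have [b' [c' [[_ _ _ [b0 c1] bcP] _ aE cE]]] := srgG.
have splitv := srg_card_nbr_split o v.
have [] := bcP v o; rewrite (srg_gdistC v o).
have swap m :
    [set w in nbr v | gdist w o == m] = [set w in nbr v | gdist o w == m].
  by apply/setP=> w; rewrite !inE srg_gdistC.
have swapS m :
    [set w in nbr v | (gdist w o).+1 == m.+1] = [set w in nbr v | gdist o w == m].
  by rewrite -swap; apply/setP=> w; rewrite !inE eqSS.
have card0 : #|[set w in nbr v | gdist o w == 0]| = adj v o.
  rewrite (_ : [set _ in _ | _] = if adj v o then [set o] else set0).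
    by case: ifP; rewrite (cards1, cards0).
  apply/setP=> w; rewrite !inE gdist_eq0.
  case: eqVneq => [<-|ow]; case: ifP => // vo; rewrite !inE ?eqxx ?andbF //.
  by rewrite eq_sym (negPf ow).
move: card0 (srg_gdist_le2 o v); rewrite -gdist_eq1 srg_gdistC.
case: (gdist o v) => [|[|[|?]]] //= card0 _ cP bP.
(* The second known entry is in turn [b' 0 = k], [b' 1 = k - a - 1] and [c' 2 = c], for [v] at
   distance 0, 1 and 2 from [o]. *)
- have := bP isT; rewrite b0 swap => card1.
  by case: t t2 => [|[|[|?]]] //= _; rewrite /srg_intersection /=; lia.
- have := bP isT; rewrite swap => card2.
  by case: t t2 => [|[|[|?]]] //= _; rewrite /srg_intersection /=; lia.
- have := cP isT; rewrite swapS -cE => card1.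
  by case: t t2 => [|[|[|?]]] //= _; rewrite /srg_intersection /=; lia.
Qed.

(** A single path [u], [w], [v] realising the diameter shows that [k] and [b' 1] are positive. As
    these counts are the same everywhere, any [o] has a neighbour [x], and [x] has a neighbour at
    distance 2 from [o]. *)
Lemma srg_level_nonempty o t : t <= 2 -> exists v, gdist o v = t.
Proof.
have [b' [c' [[regG conG diamG [b0 c1] bcP] _ aE cE]]] := srgG.
have [u [v uv2]] : exists u v, gdist u v = 2.
  have /card_gt0P[x _] : 0 < #|G|.
    (* On an empty vertex set the maximum would be 0 instead of 2. *)
    rewrite lt0n; apply/eqP => /card0_eq G0; move: diamG; rewrite /diameter.
    by rewrite big1 // => i; have := G0 i; rewrite inE.
  move: diamG; rewrite /diameter (bigmax_eq_arg x) // => <-.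
  set u := [arg max_(_ > _) _]; exists u.
  rewrite (bigmax_eq_arg x) //; set v := [arg max_(_ > _) _]; by exists v.
have [w uw wv] : exists2 w, adj u w & adj w v.
  by apply/walk2P; rewrite -uv2 walk_gdist.
have k_gt0 : 0 < k by rewrite -(regG u); apply/card_gt0P; exists w; rewrite inE.
have b1_gt0 : 0 < b' 1.
  have /eqP wv1 : gdist w v == 1 by rewrite gdist_eq1.
  have [_] := bcP w v; rewrite wv1 => /(_ isT) <-.
  by apply/card_gt0P; exists u; rewrite !inE adj_sym uw uv2.
have [x ox] : exists x, adj o x.
  by move: k_gt0; rewrite -(regG o) => /card_gt0P[x]; rewrite inE; exists x.
case: t => [|[|[|?]]] // _.
- by exists o; apply/eqP; rewrite gdist_eq0.
- by exists x; apply/eqP; rewrite gdist_eq1.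
have /eqP xo1 : gdist x o == 1 by rewrite gdist_eq1 adj_sym.
have [_] := bcP x o; rewrite xo1 => /(_ isT) b1E.
move: b1_gt0; rewrite -b1E => /card_gt0P[y]; rewrite !inE => /andP[_ /eqP y2].
by exists y; rewrite srg_gdistC.
Qed.

End StronglyRegular.

Lemma card_cart_nbr_level (G1 G2 : sgraph) (o v : cart G1 G2) (t1 t2 : nat) :
  #|nbr v :&: level (G := cart G1 G2) (@dist_pair G1 G2) o (t1, t2)|
    = (gdist o.1 v.1 == t1) * #|[set w in nbr v.2 | gdist o.2 w == t2]|
      + (gdist o.2 v.2 == t2) * #|[set w in nbr v.1 | gdist o.1 w == t1]|.
Proof.
case: o v => [o1 o2] [v1 v2] /=.
set N1 := [set w in nbr v1 | _]; set N2 := [set w in nbr v2 | _].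
(* [S1] collects the neighbours in the cell that keep the first coordinate, [S2] those that keep the
   second. A common element would make [v1] adjacent to itself. *)
pose S1 : {set cart G1 G2} :=
  if gdist o1 v1 == t1 then setX [set v1] N2 else set0.
pose S2 : {set cart G1 G2} :=
  if gdist o2 v2 == t2 then setX N1 [set v2] else set0.
have -> : nbr (G := cart G1 G2) (v1, v2)
    :&: level (G := cart G1 G2) (@dist_pair G1 G2) (o1, o2) (t1, t2) = S1 :|: S2.
  apply/setP=> -[w1 w2]; rewrite !inE /adj /= /cart_adj /dist_pair /= xpair_eqE.
  rewrite /S1 /S2 (fun_if (fun A : {set _} => (w1, w2) \in A)).
  rewrite [in RHS](fun_if (fun A : {set _} => (w1, w2) \in A)) !inE /=.
  case: (eqVneq v1 w1) => [<-|v1w1]; case: (eqVneq v2 w2) => [<-|v2w2];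
    rewrite ?adj_irr ?eqxx ?(eq_sym w1) ?(eq_sym w2) ?(negPf v1w1) ?(negPf v2w2) /=;
    by do ?case: (gdist _ _ == _); rewrite ?andbT ?andbF ?orbT ?orbF.
rewrite cardsU (_ : S1 :&: S2 = set0) ?cards0 ?subn0; last first.
  apply/setP=> -[w1 w2]; rewrite /S1 /S2.
  case: ifP => _; case: ifP => _; rewrite !inE ?andbF //=.
  by case: eqVneq => [->|_]; rewrite ?adj_irr ?andbF.
congr (_ + _); rewrite /S1 /S2; case: ifP => _;
  by rewrite ?cards0 ?cardsX ?cards1 ?mul1n ?muln1.
Qed.

(** The cells are the fibres of [f (o, _)], hence a partition once every listed value is attained;
    equal neighbour counts within a cell can be read off from [Q]. *)
Lemma f_equitableI (G : sgraph) (X : eqType) (r : nat) (f : G * G -> X)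
    (x : r.+1.-tuple X) (Q : 'M[int]_r.+1) :
    uniq x -> (forall u v, f (u, v) \in x) ->
    (forall o, level f o (tnth x ord0) = [set o]) ->
    (forall o i, exists v, f (o, v) = tnth x i) ->
    (forall o, is_quotient_matrix (fun i => level f o (tnth x i)) Q) ->
  f_equitable f x Q.
Proof.
move=> Ux fx lev0 ne QP; split=> // o; split=> //; split; last first.
  move=> _ _ /imsetP[i _ ->] /imsetP[j _ ->] u v uj vj.
  by have [] : Posz #|nbr u :&: level f o (tnth x i)|
    = Posz #|nbr v :&: level f o (tnth x i)| by rewrite -!(QP o i j).
rewrite (_ : imset _ _ = preim_partition (fun v => f (o, v)) setT).
  exact: preim_partitionP.
apply/setP=> A; apply/imsetP/imsetP => [[i _ ->]|[v _ ->]].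
  have [v fv] := ne o i; exists v => //.
  by apply/setP=> w; rewrite !inE fv eq_sym.
have /tnthP[i fi] := fx o v; exists i => //.
by apply/setP=> w; rewrite !inE fi eq_sym.
Qed.

Theorem corollary5p1 (G1 G2 : sgraph) (n1 k1 a1 c1 n2 k2 a2 c2 : nat)
    (h1 : strongly_regular G1 n1 k1 a1 c1)
    (h2 : strongly_regular G2 n2 k2 a2 c2) :
  f_equitable (G := cart G1 G2) (@dist_pair G1 G2) dist_values
    (srg_cart_matrix (Posz k1) (Posz a1) (Posz c1)
       (Posz k2) (Posz a2) (Posz c2)).
Proof.
have values_le2 i : (tnth dist_values i).1 <= 2 /\ (tnth dist_values i).2 <= 2.
  by case: i => [[|[|[|[|[|[|[|[|[|?]]]]]]]]]].
apply: f_equitableI => //.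
- move=> [u1 u2] [v1 v2]; rewrite /dist_pair /=.
  have := srg_gdist_le2 h1 u1 v1; have := srg_gdist_le2 h2 u2 v2.
  by case: (gdist u1 v1) (gdist u2 v2) => [|[|[|?]]] [|[|[|?]]].
- move=> [o1 o2]; apply/setP=> -[v1 v2].
  rewrite !inE /dist_pair /= (tnth_nth (0, 0)) /= !xpair_eqE !gdist_eq0.
  by rewrite ![_ == v1]eq_sym ![_ == v2]eq_sym.
- move=> [o1 o2] i; have [le1 le2] := values_le2 i.
  have [v1 e1] := srg_level_nonempty h1 o1 le1.
  have [v2 e2] := srg_level_nonempty h2 o2 le2.
  by exists (v1, v2); rewrite /dist_pair /= e1 e2 -surjective_pairing.
move=> o i j v; rewrite inE /dist_pair => /eqP vj.
have [le1 le2] := values_le2 i.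
rewrite [tnth dist_values i]surjective_pairing card_cart_nbr_level PoszD !PoszM.
rewrite (srg_card_nbr_level h1) // (srg_card_nbr_level h2) //.
have [-> ->] : gdist o.1 v.1 = (tnth dist_values j).1
    /\ gdist o.2 v.2 = (tnth dist_values j).2 by rewrite -vj.
rewrite mxE !(tnth_nth (0, 0)) {le1 le2 vj}.
(* Each of the 81 entries is now an explicit linear identity in the parameters, since the factors
   testing equality of distances evaluate to 0 or 1. *)
by case: i => [[|[|[|[|[|[|[|[|[|?]]]]]]]]] ?] //;
  case: j => [[|[|[|[|[|[|[|[|[|?]]]]]]]]] ?] //;
  rewrite /srg_intersection /=; lia.
Qed.
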